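(* Let $\mathcal{C}$ be an $(n,k,\delta;m)_q$-convolutional code having distance $\mathrm{dist}(\mathcal{C})=d$. Let $\hat{\mathbb{N}}=\{1,2,3,\ldots\}$ if $km=\delta$ and $\hat{\mathbb{N}}=\{0,1,2,\ldots\}$ if $km>\delta$. Put $$H_q(n,k,\delta;m):=\min_{i\in\hat{\mathbb{N}}}\left\lfloor\frac{n(m+i)q^{k(m+i)-\delta-1}(q-1)}{q^{k(m+i)-\delta}-1}\right\rfloor$$ and $$G_q(n,k,\delta;m):=\max\left\{d'\in\{1,\ldots,S(n,k,\delta)\}\ \middle|\ \sum_{l=0}^{k(m+i)-\delta-1}\left\lceil\frac{d'}{q^l}\right\rceil\leq n(m+i)\text{ for all }i\in\hat{\mathbb{N}}\right\},$$ where $S(n,k,\delta)=(n-k)\left(\left\lfloor\frac{\delta}{k}\right\rfloor+1\right)+\delta+1$. Then $$d\leq H_q(n,k,\delta;m)\ \text{ (Heller bound)}\qquad\text{and}\qquad d\leq G_q(n,k,\delta;m)\ \text{ (Griesmer bound)}.$$ Moreover, $G_q(n,k,\delta;m)\leq H_q(n,k,\delta;m)$.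
   Context: Let $\mathbb{F}=\mathbb{F}_q$ be the field with $q$ elements, $\mathbb{F}[z]$ its polynomial ring and $\mathbb{F}((z))$ the field of formal Laurent series over $\mathbb{F}$. Convolutional code: an $(n,k,\delta)_q$-convolutional code is a $k$-dimensional subspace $\mathcal{C}$ of $\mathbb{F}((z))^n$ (with $k\geq 1$) of the form $\mathcal{C}=\mathrm{im}\,G:=\{uG\mid u\in\mathbb{F}((z))^k\}$, where $G\in\mathbb{F}[z]^{k\times n}$ is right invertible over $\mathbb{F}[z]$ (there is $\tilde G\in\mathbb{F}[z]^{n\times k}$ with $G\tilde G=I_k$) and $\delta$ is the maximum of the degrees of the $k\times k$ minors of $G$. Such a $G$ is called a generator matrix of $\mathcal{C}$ and $\delta$ the complexity of $\mathcal{C}$; it does not depend on the choice of $G$. Memory: the degree of a nonzero $v=\sum_{j=0}^N v_jz^j\in\mathbb{F}[z]^n$ with $v_j\in\mathbb{F}^n$, $v_N\neq 0$ is $N$. A generator matrix $G$ with row degrees $\nu_1,\ldots,\nu_k$ is called minimal if $\delta=\sum_{i=1}^k\nu_i$. Every convolutional code has a minimal generator matrix, and the row degrees of a minimal generator matrix (the Forney indices) are uniquely determined by the code up to order. The memory of the code is $m=\max\{\nu_1,\ldots,\nu_k\}$ (so $km\geq\delta$). An $(n,k,\delta)_q$-code with memory $m$ is called an $(n,k,\delta;m)_q$-code. Distance: for $w\in\mathbb{F}^n$ let $\mathrm{wt}(w)$ be the number of nonzero entries of $w$; for $v=\sum_j v_jz^j\in\mathbb{F}[z]^n$ with $v_j\in\mathbb{F}^n$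 let $\mathrm{wt}(v)=\sum_j\mathrm{wt}(v_j)$. The (free) distance is $\mathrm{dist}(\mathcal{C})=\min\{\mathrm{wt}(v)\mid v\in\mathcal{C}\cap\mathbb{F}[z]^n,\ v\neq 0\}$. The number $S(n,k,\delta)$ is called the generalized Singleton bound; it is known (Rosenthal–Smarandache) that every $(n,k,\delta)$-convolutional code over a finite field has distance at most $S(n,k,\delta)$. *)

(* Defs.v *)
From HB Require Import structures.
From mathcomp Require Import all_boot all_order all_algebra.
From mathcomp Require Import boolp classical_sets fsbigop.
From mathcomp Require Import zify.

Set Implicit Arguments.
Unset Strict Implicit.
Unset Printing Implicit Defensive.
Import Order.TTheory GRing.Theory Num.Theory.
Local Open Scope ring_scope.

Record laurent (F : fieldType) := Laurent {
  lcoef :> int -> F;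
  laurent_lower_bound : exists N : int, forall i, i < N -> lcoef i = 0 }.

HB.instance Definition _ (F : fieldType) := gen_eqMixin (laurent F).
HB.instance Definition _ (F : fieldType) := gen_choiceMixin (laurent F).

Section LaurentField.
Variable F : fieldType.
Implicit Types (f g h : laurent F) (n N M l K : nat) (i j : int).

Lemma laurentP f g : (forall i, f i = g i) -> f = g.
Proof.
case: f => f fP; case: g => g gP /= fg.
have {}fg : f = g by apply/funext.
by case: _ / fg gP => gP; congr Laurent; apply: Prop_irrelevance.
Qed.

Definition lbound N (f : int -> F) := forall i, i < - N%:Z -> f i = 0.

Lemma lbound_le N M (f : int -> F) : (N <= M)%N -> lbound N f -> lbound M f.
Proof. by move=> NM fN i iM; apply: fN; lia. Qed.

Lemma lboundP f : exists N, lbound N f.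
Proof.
have [L fL] := laurent_lower_bound f; exists (absz (L)) => i iL; apply: fL; lia.
Qed.

Lemma Posz_lbound N (f : int -> F) : lbound N f ->
  exists L : int, forall i, i < L -> f i = 0.
Proof. by move=> fN; exists (- N%:Z). Qed.

Fact lzero_subproof : exists L : int, forall i, i < L -> 0 = 0 :> F.
Proof. by exists 0. Qed.
Definition lzero : laurent F := @Laurent F (fun=> 0) lzero_subproof.

Fact lopp_subproof f : exists L : int, forall i, i < L -> - f i = 0 :> F.
Proof.
have [N fN] := lboundP f; exists (- N%:Z) => i iN; by rewrite fN ?oppr0.
Qed.
Definition lopp f := Laurent (lopp_subproof f).

Fact ladd_subproof f g :
  exists L : int, forall i, i < L -> f i + g i = 0 :> F.
Proof.
have [N fN] := lboundP f; have [M gM] := lboundP g.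
exists (- (N + M)%N%:Z) => i iL; rewrite fN ?gM ?addr0 //; lia.
Qed.
Definition ladd f g := Laurent (ladd_subproof f g).

Fact laddA : associative ladd.
Proof. by move=> f g h; apply: laurentP => i /=; rewrite addrA. Qed.
Fact laddC : commutative ladd.
Proof. by move=> f g; apply: laurentP => i /=; rewrite addrC. Qed.
Fact ladd0 : left_id lzero ladd.
Proof. by move=> f; apply: laurentP => i /=; rewrite add0r. Qed.
Fact laddN : left_inverse lzero lopp ladd.
Proof. by move=> f; apply: laurentP => i /=; rewrite addNr. Qed.

HB.instance Definition _ :=
  GRing.isZmodule.Build (laurent F) laddA laddC ladd0 laddN.

(* The sum has finite support, so it is the usual Cauchy product. *)
Definition lconv (f g : int -> F) (i : int) : F :=
  \sum_(j \in [set: int]) f j * g (i - j).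

Lemma lbound_conv N M (f g : int -> F) :
  lbound N f -> lbound M g -> lbound (N + M) (lconv f g).
Proof.
move=> fN gM i iL; rewrite /lconv fsbig1 // => j _.
have [jN|jN] := ltP j (- N%:Z); first by rewrite fN ?mul0r.
by rewrite gM ?mulr0 //; lia.
Qed.

Fact lmul_subproof f g :
  exists L : int, forall i, i < L -> lconv f g i = 0 :> F.
Proof.
have [N fN] := lboundP f; have [M gM] := lboundP g.
exact: Posz_lbound (lbound_conv fN gM).
Qed.
Definition lmul f g := Laurent (lmul_subproof f g).

Lemma lconvE N M l (f g : int -> F) : lbound N f -> lbound M g ->
  lconv f g (l%:Z - (N + M)%N%:Z) =
  \sum_(j < l.+1) f (j%:Z - N%:Z) * g ((l - j)%N%:Z - M%:Z).
Proof.
move=> fN gM; rewrite /lconv.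
rewrite (@fsbigE _ _ _ _ _ [seq k%:Z - N%:Z | k <- iota 0 l.+1]) //; last 2 first.
- by rewrite map_inj_uniq ?iota_uniq // => a b; lia.
- move=> i _ inot.
  have [iN|iN] := ltP i (- N%:Z); first by rewrite fN ?mul0r.
  rewrite gM ?mulr0 //.
  have [il|il] := leP i (l%:Z - N%:Z); last by lia.
  case/negP: inot; apply/mapP; exists (absz (i + N%:Z)); last by lia.
  by rewrite mem_iota; lia.
rewrite big_map big_mkcond -[iota 0 l.+1]/(index_iota 0 l.+1) big_mkord.
apply: eq_bigr => j _; rewrite in_setT.
by congr (_ * g _); have := ltn_ord j; lia.
Qed.

Definition ltrunc N K (f : int -> F) : {poly F} := \poly_(l < K) f (l%:Z - N%:Z).

Lemma lconv_trunc N M K l (f g : int -> F) : lbound N f -> lbound M g ->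
  (l < K)%N ->
  lconv f g (l%:Z - (N + M)%N%:Z) = (ltrunc N K f * ltrunc M K g)`_l.
Proof.
move=> fN gM lK; rewrite lconvE // coefM; apply: eq_bigr => j _.
by rewrite !coef_poly !ifT //; have := ltn_ord j; lia.
Qed.

Lemma lbounds f g h i : exists N l,
  [/\ lbound N f, lbound N g, lbound N h & i = l%:Z - (N + N + N)%N%:Z].
Proof.
have [N1 f1] := lboundP f; have [N2 f2] := lboundP g.
have [N3 f3] := lboundP h.
pose N := (N1 + N2 + N3 + `|i|)%N; exists N, (absz (i + (N + N + N)%N%:Z)).
split; last by lia.
- by apply: lbound_le f1; lia.
- by apply: lbound_le f2; lia.
- by apply: lbound_le f3; lia.
Qed.

Fact lmulC : commutative lmul.
Proof.
move=> f g; apply: laurentP => i /=.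
have [N [l [fN gN _ ->]]] := lbounds f g f i.
have -> : l%:Z - (N + N + N)%N%:Z = l%:Z - (N + (N + N))%N%:Z :> int by lia.
have fNN : lbound (N + N) f by apply: lbound_le fN; lia.
rewrite (lconv_trunc (K := l.+1) gN fNN) // mulrC -lconv_trunc //.
by rewrite addnC.
Qed.

Fact lmulA : associative lmul.
Proof.
move=> f g h; apply: laurentP => i /=.
have [N [l [fN gN hN ->]]] := lbounds f g h i.
have fgN := lbound_conv fN gN; have ghN := lbound_conv gN hN.
rewrite (lconvE _ fgN hN) -addnA (lconvE _ fN ghN).
pose t := ltrunc N l.+1.
transitivity ((t f * (t g * t h))`_l).
  rewrite coefM; apply: eq_bigr => j _.
  rewrite [in RHS]coef_poly ltn_ord; congr (_ * _).
  by apply: lconv_trunc => //; lia.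
rewrite mulrA coefM; apply: eq_bigr => j _.
have jl : (l - j < l.+1)%N by lia.
rewrite [in LHS]mulrC [in RHS]mulrC [(t h)`_ _]coef_poly jl; congr (_ * _).
by rewrite -lconv_trunc.
Qed.

(* Posz and Negz are the constructors of int: i >= 0 resp. i < 0. *)
Definition poly_coefz (p : {poly F}) (i : int) : F :=
  if i is Posz l then p`_l else 0.

Lemma lbound_poly p N : lbound N (poly_coefz p).
Proof. by case=> //= l; lia. Qed.

Fact laurent_of_poly_subproof p :
  exists L : int, forall i, i < L -> poly_coefz p i = 0.
Proof. by exists 0; case. Qed.
Definition laurent_of_poly p := Laurent (laurent_of_poly_subproof p).

Lemma laurent_of_polyM p r :
  laurent_of_poly (p * r) = lmul (laurent_of_poly p) (laurent_of_poly r).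
Proof.
apply: laurentP => -[l|l] /=; last first.
  by rewrite (lbound_conv (@lbound_poly p 0%N) (@lbound_poly r 0%N)).
have -> : Posz l = l%:Z - (0 + 0)%N%:Z by lia.
rewrite lconvE; try exact: lbound_poly.
by rewrite coefM; apply: eq_bigr => j _; rewrite !subr0.
Qed.

Fact lmul1 : left_id (laurent_of_poly 1) lmul.
Proof.
move=> f; apply: laurentP => i /=.
have [N [l [_ fN _ ->]]] := lbounds f f f i.
have fNN : lbound (N + N + N) f by apply: lbound_le fN; lia.
rewrite -[(N + N + N)%N]add0n lconvE //; last exact: lbound_poly.
rewrite big_ord_recl /= coef1 mul1r subn0 add0n big1 ?addr0 // => j _.
by rewrite coef1 mul0r.
Qed.

Fact lmulDl : left_distributive lmul ladd.
Proof.
move=> f g h; apply: laurentP => i /=.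
have [N [l [fN gN hN ->]]] := lbounds f g h i.
have fNN : lbound (N + N) f by apply: lbound_le fN; lia.
have gNN : lbound (N + N) g by apply: lbound_le gN; lia.
have sNN : lbound (N + N) (ladd f g).
  by move=> j jN; rewrite /= fNN ?gNN ?addr0.
rewrite !lconvE // -big_split; apply: eq_bigr => j _.
exact: mulrDl.
Qed.

Fact lone_neq0 : laurent_of_poly 1 != 0.
Proof.
apply/eqP => /(congr1 (fun f : laurent F => f 0)) /=.
by rewrite coef1; apply/eqP; rewrite oner_eq0.
Qed.

HB.instance Definition _ := GRing.Zmodule_isComNzRing.Build (laurent F)
  lmulA lmulC lmul1 lmulDl lone_neq0.

Section PowerSeriesInverse.
Variable u : nat -> F.

Fixpoint inv_prefix n : seq F :=
  if n is n'.+1 then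
    let s := inv_prefix n' in
    rcons s ((u 0)^-1 *
      ((n' == 0%N)%:R - \sum_(j < n') u j.+1 * s`_(n' - j.+1)))
  else [::].

Lemma size_inv_prefix n : size (inv_prefix n) = n.
Proof. by elim: n => //= n IH; rewrite size_rcons IH. Qed.

Definition inv_series n := (inv_prefix n.+1)`_n.

Lemma nth_inv_prefix n (j : nat) : (j < n)%N -> (inv_prefix n)`_j = inv_series j.
Proof.
elim: n => // n IH; rewrite ltnS leq_eqVlt => /predU1P[-> //|jn].
by rewrite /= nth_rcons size_inv_prefix jn IH.
Qed.

Lemma inv_seriesP n : u 0%N != 0 ->
  \sum_(j < n.+1) u j * inv_series (n - j) = (n == 0%N)%:R.
Proof.
move=> u0; rewrite big_ord_recl subn0.
rewrite {1}/inv_series /= nth_rcons size_inv_prefix ltnn eqxx mulVKf //.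
rewrite [X in _ + X](_ : _ =
   \sum_(j < n) u j.+1 * (inv_prefix n)`_(n - j.+1)) ?subrK //.
by apply: eq_bigr => j _; rewrite nth_inv_prefix //; have := ltn_ord j; lia.
Qed.

End PowerSeriesInverse.

Lemma laurent_inv_ex f : f != 0 -> exists g, g * f = 1.
Proof.
move=> f0; have [N fN] := lboundP f.
have exf : exists l, f (l%:Z - N%:Z) != 0.
  apply: contrapT => /forallNP fE; case/eqP: f0; apply: laurentP => i.
  have [iN|iN] := ltP i (- N%:Z); first by rewrite fN.
  have := fE (absz (i + N%:Z)) => /negP; rewrite negbK => /eqP fi.
  by rewrite -[RHS]fi; congr (f _); lia.
pose v := ex_minn exf.
have [fv vmin] : f (v%:Z - N%:Z) != 0 /\
    forall l, f (l%:Z - N%:Z) != 0 -> (v <= l)%N.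
  by rewrite /v; case: ex_minnP.
have fz i : i < v%:Z - N%:Z -> f i = 0.
  move=> iv; have [iN|iN] := ltP i (- N%:Z); first by rewrite fN.
  apply/eqP; apply: contraTT iv => fi; rewrite -leNgt.
  have := vmin (absz (i + N%:Z)).
  have -> : (absz (i + N%:Z))%:Z - N%:Z = i by lia.
  by move=> /(_ fi); lia.
pose u n := f (n%:Z + (v%:Z - N%:Z)).
have u0 : u 0%N != 0 by rewrite /u add0r.
pose gf (i : int) := if i + (v%:Z - N%:Z) is Posz n then inv_series u n else 0.
have gM : lbound v gf by move=> i iv; rewrite /gf; case E: (_ + _) => [n|n] //; lia.
exists (Laurent (Posz_lbound gM)); rewrite mulrC; apply: laurentP => i /=.
have [iN|iN] := ltP i 0.
  rewrite [LHS]fsbig1 /= => [|j _]; first by case: i iN.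
  have [jv|jv] := ltP j (v%:Z - N%:Z); first by rewrite fz ?mul0r.
  rewrite /gf; case E: (_ + _) => [n|n]; rewrite ?mulr0 //; lia.
case: i iN => // n _ /=; rewrite coef1.
rewrite -(inv_seriesP n u0) /lconv.
rewrite (@fsbigE _ _ _ _ _ [seq k%:Z + (v%:Z - N%:Z) | k <- iota 0 n.+1]) //;
  last 2 first.
- by rewrite map_inj_uniq ?iota_uniq // => a b; lia.
- move=> i _ inot.
  have [iN|iN] := ltP i (v%:Z - N%:Z); first by rewrite fz ?mul0r.
  rewrite [gf _](_ : _ = 0) ?mulr0 //.
  have [il|il] := leP i (n%:Z + (v%:Z - N%:Z)).
    case/negP: inot; apply/mapP; exists (absz (i - (v%:Z - N%:Z))%R); last by lia.
    by rewrite mem_iota; lia.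
  by rewrite /gf; case E: (_ + _) => [m|m] //; lia.
rewrite big_map big_mkcond -[iota 0 n.+1]/(index_iota 0 n.+1) big_mkord.
apply: eq_bigr => j _; rewrite in_setT; congr (_ * _).
have jn := ltn_ord j.
by rewrite /gf; case E: (_ + _) => [m|m]; [congr inv_series|]; lia.
Qed.

Definition linv f : laurent F :=
  if pselect (exists g, g * f = 1) is left ex then projT1 (cid ex) else 0.

Fact lmulVf f : f != 0 -> linv f * f = 1.
Proof.
move=> /laurent_inv_ex exf; rewrite /linv.
by case: pselect => // ex; case: cid.
Qed.

Fact linv0 : linv 0 = 0.
Proof.
rewrite /linv; case: pselect => // ex; case: (ex) => g g0; exfalso.
by move/eqP: g0; rewrite mulr0 eq_sym oner_eq0.
Qed.

HB.instance Definition _ :=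
  GRing.ComNzRing_isField.Build (laurent F) lmulVf linv0.

Fact laurent_of_poly_is_zmod_morphism : zmod_morphism laurent_of_poly.
Proof.
move=> p r; apply: laurentP => -[l|l] /=; last by rewrite subr0.
by rewrite coefB.
Qed.
Fact laurent_of_poly_is_monoid_morphism : monoid_morphism laurent_of_poly.
Proof. by split => // p r; rewrite laurent_of_polyM. Qed.

HB.instance Definition _ := GRing.isZmodMorphism.Build _ _ laurent_of_poly
  laurent_of_poly_is_zmod_morphism.
HB.instance Definition _ := GRing.isMonoidMorphism.Build _ _ laurent_of_poly
  laurent_of_poly_is_monoid_morphism.

End LaurentField.

(* The value is 0 on the empty set. *)
Definition nat_min (A : set nat) : nat :=
  if pselect (exists n, `[< A n >]) is left ex then ex_minn ex else 0%N.

Lemma nat_minP (A : set nat) : (exists n, A n) ->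
  A (nat_min A) /\ forall n, A n -> (nat_min A <= n)%N.
Proof.
move=> [n An]; rewrite /nat_min; case: pselect => [ex|[]]; last first.
  by exists n; apply/asboolP.
by case: ex_minnP => m /asboolP Am mmin; split=> // l Al; apply/mmin/asboolP.
Qed.

Section Codes.
Variables (F : fieldType) (n : nat).

(* Degrees are [(size p).-1], so that a zero minor counts as degree 0; a right
   invertible matrix has a nonzero maximal minor. *)
Definition complexity k (G : 'M[{poly F}]_(k, n)) : nat :=
  (\max_(s : {ffun 'I_k -> 'I_n} |
         [forall i : 'I_k, forall j : 'I_k, (i < j)%N ==> (s i < s j)%N])
    (size (\det (colsub s G))).-1)%N.

Definition row_degree k (G : 'M[{poly F}]_(k, n)) (i : 'I_k) : nat :=
  (\max_(j < n) size (G i j)).-1%N.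

Definition generator_matrix k (C : {vspace 'rV[laurent F]_n})
    (G : 'M[{poly F}]_(k, n)) : Prop :=
  (exists G' : 'M[{poly F}]_(n, k), G *m G' = 1%:M) /\
  (forall v : 'rV[laurent F]_n,
     v \in C <->
     exists u : 'rV[laurent F]_k, v = u *m map_mx (@laurent_of_poly F) G).

Definition minimal_generator_matrix k (C : {vspace 'rV[laurent F]_n})
    (G : 'M[{poly F}]_(k, n)) : Prop :=
  generator_matrix C G /\ complexity G = (\sum_(i < k) row_degree G i)%N.

Definition convolutional_code (k delta : nat) (C : {vspace 'rV[laurent F]_n}) :
    Prop :=
  [/\ (1 <= k)%N, \dim C = k &
      exists G : 'M[{poly F}]_(k, n),
        generator_matrix C G /\ complexity G = delta].

(* The Forney indices do not depend on the minimal generator matrix, so at most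
   one m qualifies. *)
Definition has_memory (k : nat) (C : {vspace 'rV[laurent F]_n}) (m : nat) :
    Prop :=
  exists G : 'M[{poly F}]_(k, n),
    minimal_generator_matrix C G /\ m = (\max_(i < k) row_degree G i)%N.

Definition hamming_wt (w : 'rV[F]_n) : nat := #|[set i | w 0 i != 0]|.

Definition poly_wt (v : 'rV[{poly F}]_n) : nat :=
  (\sum_(j < \max_(i < n) size (v 0%R i)) hamming_wt (\row_i (v 0 i)`_j)%R)%N.

Definition free_distance (C : {vspace 'rV[laurent F]_n}) : nat :=
  nat_min [set w | exists v : 'rV[{poly F}]_n,
    [/\ map_mx (@laurent_of_poly F) v \in C, v != 0 & w = poly_wt v]].

End Codes.

Local Open Scope nat_scope.

Definition ceil_div (a b : nat) : nat := (a + b.-1) %/ b.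

Lemma ceil_div_leq a b c : 0 < b -> (ceil_div a b <= c) = (a <= c * b).
Proof.
by move=> b0; rewrite /ceil_div -ltnS ltn_divLR //; apply/idP/idP; lia.
Qed.

Definition singleton_bound (n k delta : nat) : nat :=
  (n - k) * (delta %/ k + 1) + delta + 1.

(* A code has km >= delta, so this is {1, 2, ...} if km = delta and
   {0, 1, 2, ...} if km > delta. *)
Definition hatN (k delta m : nat) : set nat :=
  [set i | k * m = delta -> 1 <= i].

(* As km >= delta, all subtractions below are exact for i in hatN, and the
   natural-number quotient is the floor of the quotient. *)
Definition heller_term (q n k delta m i : nat) : nat :=
  (n * (m + i) * q ^ (k * (m + i) - delta - 1) * (q - 1))
    %/ (q ^ (k * (m + i) - delta) - 1).

Definition heller_bound (q n k delta m : nat) : nat :=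
  nat_min [set h | exists2 i, hatN k delta m i & h = heller_term q n k delta m i].

Definition griesmer_cond (q n k delta m d : nat) : Prop :=
  forall i, hatN k delta m i ->
    \sum_(0 <= l < k * (m + i) - delta) ceil_div d (q ^ l) <= n * (m + i).

Definition griesmer_bound (q n k delta m : nat) : nat :=
  \max_(1 <= d < (singleton_bound n k delta).+1 |
        `[< griesmer_cond q n k delta m d >]) d.

(* Main.v *)
(* Fix L and a minimal generator matrix G with row degrees nu_j.  The messages u
   over F[z] with deg u_j < L - nu_j form an F-space of dimension at least
   kL - delta, and u |-> uG embeds it into F^(nL) as a block code of minimum
   distance at least d.  The Griesmer bound for block codes, applied for every
   L, gives the Griesmer condition (L = m + i) and the generalized Singleton
   bound (L = floor(delta / k) + 1, where kL - delta is positive).  Dropping the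
   ceilings and summing the geometric series turns it into the Heller bound. *)

Require Import Defs.
From mathcomp Require Import all_boot all_order all_algebra.
From mathcomp Require Import boolp classical_sets.
From mathcomp Require Import zify.

Set Implicit Arguments.
Unset Strict Implicit.
Unset Printing Implicit Defensive.
Import GRing.Theory.

(** * Ceilings and arithmetic of the Griesmer sum *)

Lemma ceil_div1 a : ceil_div a 1 = a.
Proof. by rewrite /ceil_div addn0 divn1. Qed.

Lemma ceil_div_geq a b : (0 < b)%N -> (a <= ceil_div a b * b)%N.
Proof. by move=> b0; rewrite -ceil_div_leq. Qed.

(** Lets the terms of the Griesmer sum of [d] with [l > 0] be read as the full sum for
    [ceil_div d q], as the induction on the dimension requires. *)
Lemma ceil_divA a b c : (0 < b)%N -> (0 < c)%N ->
  ceil_div (ceil_div a b) c = ceil_div a (b * c).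
Proof.
move=> b0 c0; have bc0 : (0 < b * c)%N by rewrite muln_gt0 b0.
apply/eqP; rewrite eqn_leq !ceil_div_leq // -!mulnA [(c * b)%N]mulnC.
by rewrite ceil_div_geq //= [(b * c)%N]mulnC mulnA -!ceil_div_leq //.
Qed.

Lemma ceil_div_sum_leqW (q K K' d N : nat) : (K <= K')%N ->
  (\sum_(0 <= l < K') ceil_div d (q ^ l) <= N)%N ->
  (\sum_(0 <= l < K) ceil_div d (q ^ l) <= N)%N.
Proof.
move=> KK'; apply: leq_trans.
by rewrite (big_cat_nat (leq0n K) KK') // leq_addr.
Qed.

(* Each of the [K] summands is positive and the one at [l = 0] is [d]. *)
Lemma griesmer_singleton (q K d N : nat) : (0 < q)%N -> (0 < d)%N ->
  (0 < K)%N -> (\sum_(0 <= l < K) ceil_div d (q ^ l) <= N)%N ->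
  (d + K <= N + 1)%N.
Proof.
move=> q0 d0; case: K => // K _; apply: contraTT.
rewrite -!ltnNge => lt; rewrite big_nat_recl // expn0 ceil_div1.
suff : (K <= \sum_(0 <= i < K) ceil_div d (q ^ i.+1))%N by lia.
rewrite -[X in (X <= _)%N]subn0 -[X in (X <= _)%N]muln1 -sum_nat_const_nat.
apply: leq_sum => i _.
by rewrite lt0n -leqn0 ceil_div_leq ?expn_gt0 ?q0 // mul0n leqn0 -lt0n.
Qed.

(** Since [d <= ceil_div d (q ^ l) * q ^ l], the [l]-th ceiling times [q ^ (K - 1)] is at least
    [d * q ^ (K - 1 - l)]; these powers of [q] sum to [(q ^ K - 1) / (q - 1)]. *)
Lemma griesmer_heller (q K d N : nat) : (1 < q)%N -> (0 < K)%N ->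
  (\sum_(0 <= l < K) ceil_div d (q ^ l) <= N)%N ->
  (d <= (N * q ^ (K - 1) * (q - 1)) %/ (q ^ K - 1))%N.
Proof.
move=> q1 K0 sumN; have q0 := ltnW q1.
rewrite leq_divRL; last by rewrite subn_gt0 -{1}(expn0 q) ltn_exp2l.
rewrite [(q ^ K - 1)%N]subn1 predn_exp -[q.-1]subn1 [((q - 1) * _)%N]mulnC.
rewrite mulnA leq_mul2r.
apply/orP; right; apply: leq_trans (leq_mul sumN (leqnn _)).
rewrite big_mkord -(big_mkord predT (fun i => q ^ i)%N) big_nat_rev /=.
rewrite big_mkord big_distrr big_distrl /=; apply: leq_sum => i _.
have -> : (q ^ (K - 1) = q ^ i * q ^ (0 + K - i.+1))%N.
  by rewrite -expnD; congr (q ^ _)%N; have := ltn_ord i; lia.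
by rewrite mulnA leq_mul2r ceil_div_geq ?orbT // expn_gt0 q0.
Qed.

Local Open Scope ring_scope.

(** * Griesmer bound for block codes *)

Section BlockGriesmer.
(** The code is given by its coordinate functionals, so that restricting it to fewer coordinates
    changes only the set [S]. *)
Variables (F : finFieldType) (V : vectType F) (T : finType) (c : V -> T -> F).
Hypothesis c_linear : forall t a u v, c (a *: u + v) t = a * c u t + c v t.

Let wt (S : {set T}) v : nat := (\sum_(t in S) (c v t != 0%R))%N.

(* Taking u of minimum weight in the code makes every term on the left at least
   wt S u, which bounds the weight of v on the zero set of u: this is the
   residual-code step of the Griesmer bound. *)
Lemma residual_wt_sum (S : {set T}) u v :
  (\sum_(a : F) wt S (a *: u + v)%R =
   #|F| * wt [set t in S | c u t == 0%R] v + (#|F| - 1) * wt S u)%N.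
Proof.
rewrite /wt exchange_big /= big_mkcond /=.
rewrite [X in (_ * X)%N]big_mkcond [X in (_ + _ * X)%N]big_mkcond /=.
rewrite !big_distrr -big_split /=; apply: eq_bigr => t _.
rewrite inE; case: (t \in S) => /=; last by rewrite !muln0.
under eq_bigr do rewrite c_linear.
have [->|ut] /= := eqVneq (c u t) 0.
  under eq_bigr do rewrite mulr0 add0r.
  by rewrite sum_nat_const cardT -cardE muln0 addn0.
(* Here exactly one scalar [a] makes coordinate [t] of [a *: u + v] vanish. *)
rewrite (bigD1 (- c v t / c u t)) //= divfK // addNr eqxx muln0 !add0n muln1.
transitivity (\sum_(a : F | a != (- c v t / c u t)%R) 1)%N.
  apply: eq_bigr => a aN; suff -> : a * c u t + c v t != 0 by [].
  by apply: contraNneq aN => /eqP; rewrite addr_eq0 => /eqP <-; rewrite mulfK.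
by rewrite sum1_card subn1 -(cardC1 (- c v t / c u t)); apply: eq_card.
Qed.

(** Induction on the dimension. The support of a nonzero [u] of minimum weight has at least [d]
    elements; a complement of its line, restricted to the zeros of [u], has minimum weight at least
    [ceil_div d #|F|]. *)
Lemma block_griesmer (U : {vspace V}) (S : {set T}) (d : nat) :
  (forall v, v \in U -> v != 0 -> (d <= wt S v)%N) ->
  (\sum_(0 <= l < \dim U) ceil_div d (#|F| ^ l) <= #|S|)%N.
Proof.
have q0 : (0 < #|F|)%N by apply/card_gt0P; exists 0.
move: {2}(\dim U) (erefl (\dim U)) => K; elim: K U S d => [|K IH] U S d dimU Ud.
  by rewrite dimU big_geq.
pose A : set nat := fun w => exists u, [/\ u \in U, u != 0 & w = wt S u].
have [|[u [uU u0 uw]] umin] := @nat_minP A.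
  exists (wt S (vpick U)), (vpick U); rewrite memv_pick vpick0.
  by rewrite -dimv_eq0 dimU.
have {uw}umin v : v \in U -> v != 0 -> (wt S u <= wt S v)%N.
  by move=> vU v0; rewrite -uw; apply: umin; exists v.
set q := #|F| in q0 IH *; pose S' := [set t in S | c u t == 0].
have cardS' : (wt S u + #|S'| = #|S|)%N.
  rewrite /wt -!sum1_card [RHS](bigID (fun t => c u t == 0)) /= addnC.
  congr (_ + _)%N; first by apply: eq_bigl => t; rewrite inE.
  by rewrite [RHS]big_mkcondr; apply: eq_bigr => t _; case: (c u t != 0).
rewrite dimU big_nat_recl // expn0 ceil_div1 -cardS' leq_add ?Ud //.
have dimL : \dim (U :\: <[u]>) = K.
  have := dimv_cap_compl U <[u]>; rewrite (capv_idPr _) ?dimU -?memvE //.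
  by rewrite dim_vline u0 => -[].
under eq_bigr do rewrite expnS -ceil_divA ?expn_gt0 ?q0 //.
rewrite -[in X in (X <= _)%N]dimL; apply: IH => // v vU v0.
(* As no [a *: u + v] vanishes, each weighs at least [wt S u]; summing over [a] then bounds
   [wt S' v] from below. *)
have vNu a : a *: u + v != 0.
  apply: contraNneq v0 => /eqP; rewrite addrC addr_eq0 => /eqP vE.
  rewrite -memv0 -(capv_diff U <[u]>) memv_cap vU vE rpredN.
  by rewrite rpredZ // memv_line.
rewrite ceil_div_leq // mulnC; apply: leq_trans (Ud u uU u0) _.
have: (q * wt S u <= q * wt S' v + (q - 1) * wt S u)%N.
  rewrite -residual_wt_sum -/q -sum_nat_const; apply: leq_sum => a _.
  by apply: umin => //; rewrite rpredD ?rpredZ // (subvP (diffvSl _ _) _ vU).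
by rewrite mulnBl mul1n; have := leq_pmull (wt S u) q0; lia.
Qed.
End BlockGriesmer.

(** * Generator matrices, weights and distance *)

Section GeneratorMatrices.
Variables (F : fieldType) (n k : nat).
Implicit Types (C : {vspace 'rV[laurent F]_n}) (G H : 'M[{poly F}]_(k, n)).

Lemma laurent_of_poly_inj : injective (@laurent_of_poly F).
Proof.
move=> p r pr; apply/polyP => i.
by have := congr1 (fun f : laurent F => f (Posz i)) pr.
Qed.

Lemma map_laurent_inj p r :
  injective (fun A : 'M_(p, r) => map_mx (@laurent_of_poly F) A).
Proof.
move=> A B /matrixP AB; apply/matrixP => i j.
by have := AB i j; rewrite !mxE => /laurent_of_poly_inj.
Qed.

(** Each row of [H] is [u *m G] with [u] over the Laurent series; multiplying by the right inverse
    [G'] shows that [u] is polynomial. *)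
Lemma generator_matrix_factor C G H : generator_matrix C G ->
  generator_matrix C H -> exists U, H = U *m G.
Proof.
move=> [[G' GG'] imG] [_ imH]; exists (H *m G').
apply: map_laurent_inj; apply/row_matrixP => i.
have /imG[u uE] : row i (map_mx (@laurent_of_poly F) H) \in C.
  by apply/imH; exists (delta_mx 0 i); rewrite rowE.
rewrite !map_mxM !row_mul uE -[u *m _ *m _]mulmxA -map_mxM GG' map_mx1.
by rewrite mulmx1.
Qed.

(** The transition matrix is invertible over the polynomials, so its determinant is a nonzero
    constant, which scales all maximal minors. *)
Lemma complexity_generator C G H : generator_matrix C G ->
  generator_matrix C H -> complexity G = complexity H.
Proof.
move=> genG genH.
have [U HE] := generator_matrix_factor genG genH.
have [V GE] := generator_matrix_factor genH genG.
have [[G' GG'] _] := genG.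
have VU1 : V *m U = 1%:M.
  by rewrite -[RHS]GG' [in RHS]GE HE -[RHS]mulmxA -!mulmxA GG' mulmx1.
have : \det U \is a GRing.unit.
  by apply/GRing.unitrPr; exists (\det V); rewrite mulrC -det_mulmx VU1 det1.
rewrite poly_unitE => /andP[/size_poly1P[a a0 detU] _].
apply: eq_bigr => s _.
by rewrite HE -mulmx_colsub det_mulmx detU mul_polyC size_scale.
Qed.

Lemma size_row_degree G i j : (size (G i j) <= (row_degree G i).+1)%N.
Proof.
apply: leq_trans (leqSpred _).
by rewrite (bigD1 j) //= leq_maxl.
Qed.

Lemma mulmx_generator_neq0 C G (u : 'rV_k) : generator_matrix C G ->
  u != 0 -> u *m G != 0.
Proof.
move=> [[G' GG'] _]; apply: contraNneq => uG0.
by rewrite -[u]mulmx1 -GG' mulmxA uG0 mul0mx.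
Qed.

Lemma mulmx_generator_in C G (u : 'rV_k) : generator_matrix C G ->
  map_mx (@laurent_of_poly F) (u *m G) \in C.
Proof.
move=> [_ imG]; apply/imG; exists (map_mx (@laurent_of_poly F) u).
by rewrite map_mxM.
Qed.

(** The leading coefficient of a nonzero entry contributes to the weight. *)
Lemma poly_wt_gt0 (v : 'rV[{poly F}]_n) : v != 0 -> (0 < poly_wt v)%N.
Proof.
move=> v0; have [i vi] : exists i, v 0 i != 0.
  by apply/existsP; apply: contraNT v0; rewrite negb_exists => /forallP vE;
    apply/eqP/rowP => i; rewrite mxE; apply/eqP; rewrite -[_ == _]negbK vE.
have s0 : ((size (v 0%R i)).-1 < \max_(i < n) size (v 0%R i))%N.
  rewrite -ltnS prednK ?size_poly_gt0 // ltnS.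
  by rewrite (bigD1 i) //= leq_maxl.
rewrite /poly_wt (bigD1 (Ordinal s0)) //= ltn_addr //.
by apply/card_gt0P; exists i; rewrite inE !mxE -lead_coefE lead_coef_eq0.
Qed.

Lemma poly_wt_leq (v : 'rV[{poly F}]_n) (L : nat) :
  (forall i, (size (v 0%R i) <= L)%N) ->
  (poly_wt v <= \sum_(t : 'I_n * 'I_L) ((v 0 t.1)`_t.2 != 0)%R)%N.
Proof.
move=> vL.
have maxL : (\max_(i < n) size (v 0%R i) <= L)%N by apply/bigmax_leqP.
rewrite -(pair_bigA _ (fun (i : 'I_n) (j : 'I_L) => (v 0 i)`_j != 0 : nat)) /=.
rewrite exchange_big /=.
apply: (@leq_trans (\sum_(j < L) hamming_wt (\row_i (v 0%R i)`_j)%R)%N).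
  rewrite /poly_wt.
  rewrite (big_ord_widen _ (fun j => hamming_wt (\row_i (v 0%R i)`_j)%R) maxL).
  by rewrite big_mkcond; apply: leq_sum => j _; case: ifP.
apply: leq_sum => j _; rewrite /hamming_wt -sum1_card big_mkcond.
by apply: leq_sum => i _; rewrite inE mxE; case: (_ != 0).
Qed.

Lemma free_distance_leq C (v : 'rV[{poly F}]_n) :
  map_mx (@laurent_of_poly F) v \in C -> v != 0 ->
  (free_distance C <= poly_wt v)%N.
Proof.
move=> vC v0; rewrite /free_distance; set A := (A in nat_min A).
have Av : A (poly_wt v) by exists v.
exact: (nat_minP (ex_intro _ _ Av)).2.
Qed.

(** Encoding the all-ones message shows that the set of weights is nonempty, which excludes the
    default value 0 of [nat_min]. *)
Lemma free_distance_gt0 C G : (0 < k)%N -> generator_matrix C G ->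
  (0 < free_distance C)%N.
Proof.
move=> k0 genG; rewrite /free_distance; set A := (A in nat_min A).
suff /nat_minP[[v [_ v0 ->]] _] : exists w, A w by apply: poly_wt_gt0.
have u0 : (const_mx 1 : 'rV[{poly F}]_k) != 0.
  apply/eqP => /rowP /(_ (Ordinal k0)); rewrite !mxE; apply/eqP.
  exact: oner_neq0.
exists (poly_wt (const_mx 1 *m G)), (const_mx 1 *m G); split => //.
  exact: mulmx_generator_in.
exact: mulmx_generator_neq0 genG u0.
Qed.
End GeneratorMatrices.

(** * Block codes inside a convolutional code *)

Lemma code_griesmer (F : finFieldType) (n k delta L : nat)
    (C : {vspace 'rV[laurent F]_n}) (G : 'M[{poly F}]_(k, n)) :
  generator_matrix C G -> (\sum_(i < k) row_degree G i)%N = delta ->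
  (\sum_(0 <= l < k * L - delta) ceil_div (free_distance C) (#|F| ^ l)
     <= n * L)%N.
Proof.
move=> genG sumG.
pose nu := row_degree G.
(* A pair [(j, l)] in [I] stands for the monomial ['X^l] in message entry [j]; [msg] assembles a
   message from its coefficients. *)
pose I := {x : 'I_k * 'I_L | (x.2 + nu x.1 < L)%N}.
pose msg (w : {ffun I -> F^o}) : 'rV[{poly F}]_k :=
  \row_j \sum_(x : I | (val x).1 == j) w x *: 'X^((val x).2).
have msgZD a w w' : msg (a *: w + w') = a%:P *: msg w + msg w'.
  apply/rowP => j; rewrite !mxE big_distrr -big_split /=.
  by apply: eq_bigr => x _; rewrite !ffunE scalerDl mul_polyC scalerA.
have msg_neq0 w : w != 0 -> msg w != 0.
  apply: contraNneq => msg0; apply/eqP/ffunP => x; rewrite ffunE.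
  have /rowP/(_ (val x).1)/(congr1 (coefp (val x).2)) := msg0.
  rewrite !mxE /= coef0 coef_sum (bigD1 x) //= coefZ coefXn eqxx mulr1.
  rewrite big1 ?addr0 // => y /andP[y1 yx]; rewrite coefZ coefXn.
  case: eqP => [y2|]; last by rewrite mulr0.
  have yx' : val y = val x.
    rewrite [LHS]surjective_pairing (eqP y1) -(val_inj y2).
    by rewrite -surjective_pairing.
  by rewrite (val_inj yx') eqxx in yx.
have size_msg w j : (size (msg w 0%R j) <= L - nu j)%N.
  rewrite mxE; apply: (leq_trans (size_sum _ _ _)).
  apply/bigmax_leqP => x /eqP <-.
  apply: leq_trans (size_scale_leq _ _) _; rewrite size_polyXn.
  by have := valP x => /=; lia.
pose c w (t : 'I_n * 'I_L) := ((msg w *m G) 0 t.1)`_t.2.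
have cZD t a w w' : c (a *: w + w') t = a * c w t + c w' t.
  by rewrite /c msgZD mulmxDl -scalemxAl !mxE coefD mul_polyC coefZ.
have dimI : (k * L - delta <= \dim (fullv : {vspace {ffun I -> F^o}}))%N.
  rewrite dimvf /dim /= muln1 card_sig -sum1_card.
  rewrite (eq_bigl (fun x : 'I_k * 'I_L => true && (x.2 < L - nu x.1)%N));
    last first.
    by move=> x; rewrite !inE /= ltn_subRL addnC.
  rewrite -(pair_big_dep predT (fun j (l : 'I_L) => (l < L - nu j)%N)
    (fun _ _ => 1%N)) /=.
  (* Truncated subtraction only helps: rows with [nu j > L] count 0 instead of a negative number. *)
  apply: (@leq_trans (\sum_(j < k) (L - nu j))).
    rewrite leq_subLR -sumG -big_split /= -[X in (X * _)%N]card_ord.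
    rewrite -sum_nat_const; apply: leq_sum => j _.
    by rewrite -leq_subLR.
  apply: leq_sum => j _.
  by rewrite -(big_ord_widen _ (fun=> 1%N) (leq_subr _ _)) sum1_card card_ord.
have -> : (n * L)%N = #|[set: 'I_n * 'I_L]|.
  by rewrite cardsT card_prod !card_ord.
apply: (ceil_div_sum_leqW dimI); apply: (block_griesmer cZD) => w _ w0.
apply: (@leq_trans (poly_wt (msg w *m G))).
  apply: free_distance_leq; first exact: mulmx_generator_in.
  exact: mulmx_generator_neq0 genG (msg_neq0 _ w0).
rewrite (eq_bigl predT) => [|t]; last by rewrite inE.
apply: poly_wt_leq => i; rewrite mxE.
apply: (leq_trans (size_sum _ _ _)); apply/bigmax_leqP => j _.
(* For a zero entry the bound of [size_polyMleq] is too weak when [nu j > L]. *)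
have [->|m0] := eqVneq (msg w 0 j) 0; first by rewrite mul0r size_poly0.
apply: leq_trans (size_polyMleq _ _) _.
have := size_row_degree G j i; have := size_msg w j; rewrite -/(nu j).
move: m0; rewrite -size_poly_gt0.
by move: (size (msg w 0%R j)) (size (G j i)) => a b; lia.
Qed.

Theorem theorem3p4 (F : finFieldType) (n k delta m d : nat)
    (C : {vspace 'rV[laurent F]_n})
    (C_code : convolutional_code k delta C)
    (C_memory : has_memory k C m)
    (C_dist : free_distance C = d) :
  [/\ (d <= heller_bound #|F| n k delta m)%N,
      (d <= griesmer_bound #|F| n k delta m)%N &
      (griesmer_bound #|F| n k delta m <= heller_bound #|F| n k delta m)%N].
Proof.
have [k0 _ [H [genH deltaH]]] := C_code.
have [G [[genG sumG] mG]] := C_memory.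
(* [delta] is witnessed by [H] and the memory by [G], possibly different matrices. *)
have {}sumG : (\sum_(i < k) row_degree G i)%N = delta.
  by rewrite -sumG (complexity_generator genG genH).
have q1 : (1 < #|F|)%N := card_finNzRing_gt1 F.
have km : (delta <= k * m)%N.
  rewrite -sumG -[X in (_ <= X * _)%N]card_ord -sum_nat_const.
  by apply: leq_sum => i _; rewrite mG (bigD1 i) //= leq_maxl.
have d0 : (0 < d)%N by rewrite -C_dist; apply: free_distance_gt0 genG.
have griesmer L :
    (\sum_(0 <= l < k * L - delta) ceil_div d (#|F| ^ l) <= n * L)%N.
  by rewrite -C_dist; apply: code_griesmer genG sumG.
have dS : (d <= singleton_bound n k delta)%N.
  (* [delta %/ k + 1] is the least [L] with [k * L > delta]. *)
  have L0 : (0 < k * (delta %/ k + 1) - delta)%N.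
    by rewrite subn_gt0 mulnC addn1 ltn_ceil.
  have := griesmer_singleton (ltnW q1) d0 L0 (griesmer _).
  by rewrite /singleton_bound mulnBl; move: L0; set L := (_ %/ _ + 1)%N; lia.
have d_griesmer : (d <= griesmer_bound #|F| n k delta m)%N.
  apply: (@leq_bigmax_seq _ _ _ id); first by rewrite mem_index_iota d0 ltnS.
  by apply/asboolP => i _.
suff griesmer_leq :
    (griesmer_bound #|F| n k delta m <= heller_bound #|F| n k delta m)%N.
  by split => //; apply: leq_trans griesmer_leq.
rewrite /griesmer_bound big_seq_cond; apply/bigmax_leqP_seq => e _.
move=> /andP[_ /asboolP e_griesmer].
rewrite /heller_bound; set A := (A in nat_min A).
(* The minimum is attained at some [i], so one Heller term suffices; 1 lies in [hatN] in both
   cases. *)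
have [|[i ihat ->] _] := @nat_minP A.
  by exists (heller_term #|F| n k delta m 1); exists 1%N.
rewrite /heller_term; apply: griesmer_heller => //; last exact: e_griesmer.
(* Both forms of [hatN] make the number of summands positive. *)
have [kmd|kmd] := eqVneq (k * m)%N delta.
  by have := ihat kmd; rewrite subn_gt0 -kmd ltn_pmul2l //; lia.
by rewrite subn_gt0; nia.
Qed.
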